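(* Let $f\colon\mathbb{R}\to\mathbb{R}$ be a continuous function whose graph $\{(x,f(x)) : x\in\mathbb{R}\}\subset\mathbb{R}^2$ is affinely ambient homogeneous. Then $f$ is differentiable at every point of $\mathbb{R}$ (where a derivative equal to $+\infty$ or equal to $-\infty$ is allowed). Moreover, the derivative of $f$ is continuous (where continuity at a point with infinite derivative is understood in the sense given in the context).
   Context: A subset $N\subset\mathbb{R}^m$ is called affinely ambient homogeneous if for any two points $x,y\in N$ there is an affine transformation $h\colon\mathbb{R}^m\to\mathbb{R}^m$ (an invertible affine map) such that $h(x)=y$ and $h$ takes $N$ to itself, i.e. $h(N)=N$. Convention on infinite derivatives: if the derivative of $f$ at a point (the limit of the difference quotients) equals $+\infty$ or equals $-\infty$, then $f$ is considered differentiable at this point. Continuity of the derivative at such a point $x_0$ means that the derivative $f'(x)$ is infinitely large as $x\to x_0$, i.e. $|f'(x)|\to\infty$ as $x\to x_0$. *)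

(* Defs.v *)
From mathcomp Require Import all_boot all_order all_algebra.
From mathcomp Require Import all_classical all_reals all_analysis.
Set Implicit Arguments.
Unset Strict Implicit.
Unset Printing Implicit Defensive.
Import Order.TTheory GRing.Theory Num.Theory.
Import numFieldNormedType.Exports.
Local Open Scope classical_set_scope.
Local Open Scope ring_scope.

Definition affine_transformation (R : realType) (m : nat)
    (h : 'cV[R]_m -> 'cV[R]_m) : Prop :=
  exists (A : 'M[R]_m) (b : 'cV[R]_m),
    A \in unitmx /\ forall x, h x = A *m x + b.

Definition affinely_ambient_homogeneous (R : realType) (m : nat)
    (N : set 'cV[R]_m) : Prop :=
  forall x y, N x -> N y ->
    exists h, [/\ affine_transformation h, h x = y & h @` N = N].

Definition vec2 (R : realType) (x y : R) : 'cV[R]_2 :=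
  \col_(i < 2) (if i == 0 then x else y).

Definition graph_of (R : realType) (f : R -> R) : set 'cV[R]_2 :=
  [set vec2 x (f x) | x in setT].

(* The limits of difference quotients are taken in the extended reals, so that
   [cvg] and [lim] below cover derivatives equal to +oo or to -oo. *)
Definition diff_quotient (R : realType) (f : R -> R) (x h : R) : \bar R :=
  ((f (x + h) - f x) / h)%:E.

Definition ederivable (R : realType) (f : R -> R) (x : R) : Prop :=
  cvg (diff_quotient f x h @[h --> 0^']).

(* Meaningful only when [ederivable f x]. *)
Definition ederive (R : realType) (f : R -> R) (x : R) : \bar R :=
  lim (diff_quotient f x h @[h --> 0^']).

(* At a point with infinite derivative only the absolute value of the
   derivative has to tend to +oo: the sign may vary nearby.  At a point with
   finite derivative, convergence in [\bar R] forces the derivative to be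
   finite on a neighborhood. *)
Definition ederive_continuous_at (R : realType) (f : R -> R) (x0 : R) : Prop :=
  if ederive f x0 is r%:E then ederive f x @[x --> x0] --> r%:E
  else `|ederive f x|%E @[x --> x0] --> +oo%E.

(* Main.v *)
Require Import Defs.
From mathcomp Require Import all_boot all_order all_algebra.
From mathcomp Require Import all_classical all_reals all_analysis.
From mathcomp Require Import ring lra.
Set Implicit Arguments.
Unset Strict Implicit.
Import Order.TTheory GRing.Theory Num.Theory.
Import numFieldNormedType.Exports.
Local Open Scope classical_set_scope.
Local Open Scope ring_scope.

(** By Baire's theorem the affine symmetries of the graph that are close to the
identity already move a point to all nearby points (Effros).  Every interval
contains a point where the graph is touched from above by a parabola; a symmetry
close to the identity distorts that parabola only slightly, so all nearby points
are touched from above by parabolas of bounded opening.  Repeating this inside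
the neighborhood with parabolas from below, one finds an interval on which the
graph is squeezed between two uniform parabolas at each point, hence [f] is
C^{1,1} there.  A symmetry with linear part [((a, b), (c, d))] acts on slopes by
[t |-> (c + d t) / (a + b t)], which carries this regularity to every point, the
vertical tangents being the poles. *)

(** * Linear parts of the symmetries of the graph *)

(** Matrices are nested pairs, so that compactness of boxes and continuity of entries come from the
    product topology. *)
Definition mul2 {R : realType} (N M : (R * R) * (R * R)) : (R * R) * (R * R) :=
  ((N.1.1 * M.1.1 + N.1.2 * M.2.1, N.1.1 * M.1.2 + N.1.2 * M.2.2),
   (N.2.1 * M.1.1 + N.2.2 * M.2.1, N.2.1 * M.1.2 + N.2.2 * M.2.2)).

Definition id2 {R : realType} : (R * R) * (R * R) := ((1, 0), (0, 1)).

(* The affine map with linear part [M] sending [(x, f x)] to [(y, f y)] maps the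
   graph of [f] into itself. *)
Definition carries {R : realType} (f : R -> R) (M : (R * R) * (R * R)) (x y : R) :=
  forall w, f (y + (M.1.1 * (w - x) + M.1.2 * (f w - f x))) =
            f y + (M.2.1 * (w - x) + M.2.2 * (f w - f x)).

(** An affine map is determined by its linear part and one image point, so every graph point can
    serve as base point. *)
Lemma carries_image {R : realType} (f : R -> R) M x y w : carries f M x y ->
  carries f M w (y + (M.1.1 * (w - x) + M.1.2 * (f w - f x))).
Proof.
move=> fM u; rewrite fM.
have -> : f y + (M.2.1 * (w - x) + M.2.2 * (f w - f x)) +
   (M.2.1 * (u - w) + M.2.2 * (f u - f w)) =
   f y + (M.2.1 * (u - x) + M.2.2 * (f u - f x)) by ring.
by rewrite -fM; congr (f _); ring.
Qed.

Lemma carries_comp {R : realType} (f : R -> R) M N x y z :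
  carries f M x y -> carries f N y z -> carries f (mul2 N M) x z.
Proof.
move=> fM fN w; have := fN (y + (M.1.1 * (w - x) + M.1.2 * (f w - f x))).
rewrite fM /= => h.
transitivity (f z +
   (N.2.1 * (y + (M.1.1 * (w - x) + M.1.2 * (f w - f x)) - y) +
    N.2.2 * (f y + (M.2.1 * (w - x) + M.2.2 * (f w - f x)) - f y))).
  by rewrite -h; congr (f _); ring.
by ring.
Qed.

(** Conjugation by the reflection [(x, y) -> (x, - y)], used to turn parabolas from above into
    parabolas from below. *)
Lemma carriesN {R : realType} (f : R -> R) M x y : carries f M x y ->
  carries (fun z => - f z) ((M.1.1, - M.1.2), (- M.2.1, M.2.2)) x y.
Proof.
move=> fM w /=.
have -> : - f y + (- M.2.1 * (w - x) + M.2.2 * (- f w - - f x)) =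
   - (f y + (M.2.1 * (w - x) + M.2.2 * (f w - f x))) by ring.
by rewrite -fM; congr (- f _); ring.
Qed.

(** Invertibility is recorded by an explicit inverse which, unlike a nonzero determinant, is a
    closed condition. The inverse preserves the graph because [h] maps the graph onto itself. *)
Lemma homogeneous_carries {R : realType} (f : R -> R) :
  affinely_ambient_homogeneous (graph_of f) ->
  forall x y, exists M N, [/\ mul2 N M = id2, mul2 M N = id2,
     carries f M x y & carries f N y x].
Proof.
move=> hf x y.
have gr z : graph_of f (vec2 z (f z)) by exists z.
have [h [[A [b [uA hE]]] hxy hN]] := hf _ _ (gr x) (gr y).
pose toM (A : 'M[R]_2) := ((A 0 0, A 0 1), (A 1 0, A 1 1)).
have toM_mul (B C : 'M[R]_2) : mul2 (toM B) (toM C) = toM (B *m C).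
  have ord01 : lift ord0 ord0 = 1 :> 'I_2 by apply/val_inj.
  by rewrite /mul2 /toM /= !mxE !big_ord_recl !big_ord0 !ord01 !addr0.
have toM1 : toM 1%:M = id2 by rewrite /toM !mxE /=.
have dif z w : vec2 z (f z) - vec2 w (f w) = vec2 (z - w) (f z - f w).
  by apply/matrixP => i j; rewrite !mxE; case: ifP.
have mulv (B : 'M[R]_2) u v : B *m vec2 u v =
    vec2 (B 0 0 * u + B 0 1 * v) (B 1 0 * u + B 1 1 * v).
  have ord01 : lift ord0 ord0 = 1 :> 'I_2 by apply/val_inj.
  apply/matrixP => i j; rewrite !mxE !big_ord_recl big_ord0 !mxE /= addr0 !ord01.
  by case: (unliftP 0 i) => [k|] ->; rewrite ?(ord1 k) ?ord01.
have vec2_inj a c a' c' : vec2 a c = vec2 a' c' :> 'cV[R]_2 -> a = a' /\ c = c'.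
  move=> /matrixP e; have := e 0 0; have := e 1 0.
  by rewrite !mxE /=.
have hdif w z : h w - h z = A *m (w - z) by rewrite !hE mulmxBr; apply/matrixP=> i j; rewrite !mxE; ring.
exists (toM A), (toM (invmx A)); split.
- by rewrite toM_mul mulVmx.
- by rewrite toM_mul mulmxV.
- move=> w; have : graph_of f (h (vec2 w (f w))) by rewrite -hN; exists (vec2 w (f w)).
  case=> z _ hz; have := hdif (vec2 w (f w)) (vec2 x (f x)).
  rewrite hxy -hz !dif mulv => /vec2_inj [e1 e2] /=.
  rewrite -e1 -e2; have -> : y + (z - y) = z by ring.
  by ring.
- move=> w; have : (h @` graph_of f) (vec2 w (f w)) by rewrite hN.
  case=> _ [z _ <-] hz; have := hdif (vec2 z (f z)) (vec2 x (f x)).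
  rewrite hxy hz !dif => e; have := congr1 (mulmx (invmx A)) e.
  rewrite mulmxA mulVmx // mul1mx mulv => /vec2_inj [e1 e2] /=.
  rewrite e1 e2; have -> : x + (z - x) = z by ring.
  by ring.
Qed.

(** * Baire category and symmetries close to the identity *)

(** Tube lemma: compactness of [K] gives a point outside the projection one neighborhood whose
    product with [K] avoids [C]. *)
Lemma closed_proj_compact {T U : topologicalType} (K : set T) (C : set (T * U)) :
  compact K -> closed C -> closed [set y | exists2 p, K p & C (p, y)].
Proof.
move=> /compact_near_coveringP cK cC.
rewrite -openC openE => y yS; rewrite /interior.
have := cK U (nbhs y) (fun y p => ~ C (p, y)) _.
have H : forall x, K x -> \forall x' \near x & i \near y, ~ C (x', i).
  move=> p Kp; have : nbhs (p, y) (~` C).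
    by apply: open_nbhs_nbhs; split; [rewrite openC | move=> Cp; apply: yS; exists p].
  by case=> [[A B] /= nAB AB]; exists (A, B) => // -[z1 z2] Az; exact: (AB (z1, z2) Az).
move=> /(_ _ H); apply: filterS => u Hu [p Kp Cp]; exact: Hu Kp Cp.
Qed.

(** If no [S i] had interior, the complements would be open and dense, and Baire's theorem would
    give a point outside every [S i]. *)
Lemma closed_cover_interior {R : realType} (J : countType) (S : J -> set R) :
  (forall i, closed (S i)) -> (forall x, exists i, S i x) ->
  exists i (x : R), nbhs x (S i).
Proof.
move=> cS cov; apply: contrapT => nint.
(* Integers that encode no index get the whole line, which is open and dense. *)
pose F n : set R := if unpickle n is Some i then ~` S i else setT.
have odF n : open (F n) /\ dense (F n).
  rewrite /F; case: (unpickle n) => [i|]; last first.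
    by split; [exact: openT | move=> O [x Ox] _; exists x].
  split; first by rewrite openC.
  move=> O [x Ox] oO; apply: contrapT => e; apply: nint; exists i, x.
  have nO : nbhs x O by apply: open_nbhs_nbhs.
  apply: filterS nO => z Oz; apply: contrapT => Sz; apply: e; by exists z.
have := @Baire R R^o F odF setT; case.
- by exists 0.
- exact: openT.
move=> x [_ Fx]; have [i Six] := cov x.
by have := Fx (pickle i) I; rewrite /F pickleK => /(_ Six).
Qed.

Definition near_id {R : realType} (eps : R) (M : (R * R) * (R * R)) :=
  [/\ `|M.1.1 - 1| <= eps, `|M.1.2| <= eps, `|M.2.1| <= eps &
      `|M.2.2 - 1| <= eps].

Definition box {R : realType} (q : (R * R) * (R * R)) (e : R) :
    set ((R * R) * (R * R)) :=
  (`[q.1.1 - e, q.1.1 + e] `*` `[q.1.2 - e, q.1.2 + e]) `*`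
  (`[q.2.1 - e, q.2.1 + e] `*` `[q.2.2 - e, q.2.2 + e]).

Lemma boxP {R : realType} (q : (R * R) * (R * R)) (e : R) M : box q e M <->
  (`|M.1.1 - q.1.1| <= e /\ `|M.1.2 - q.1.2| <= e) /\
  (`|M.2.1 - q.2.1| <= e /\ `|M.2.2 - q.2.2| <= e).
Proof. by rewrite /box /setX /= !in_itv /= !ler_distl. Qed.

Lemma box_compact {R : realType} (q : (R * R) * (R * R)) (e : R) :
  compact (box q e).
Proof. by do 2!apply: compact_setX; exact: segment_compact. Qed.

Section continuity.
Context {R : realType} {T : topologicalType}.
Implicit Types g h : T -> R.

Lemma fctD_continuous g h : continuous g -> continuous h ->
  continuous (fun t => g t + h t).
Proof. by move=> cg ch t; apply: cvgD; [exact: cg|exact: ch]. Qed.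

Lemma fctB_continuous g h : continuous g -> continuous h ->
  continuous (fun t => g t - h t).
Proof. by move=> cg ch t; apply: cvgB; [exact: cg|exact: ch]. Qed.

Lemma fctM_continuous g h : continuous g -> continuous h ->
  continuous (fun t => g t * h t).
Proof. by move=> cg ch t; apply: cvgM; [exact: cg|exact: ch]. Qed.

End continuity.

Lemma continuous_fst {T U V : topologicalType} (g : T -> U * V) :
  continuous g -> continuous (fun t => (g t).1).
Proof. by move=> cg t; apply: (cvg_comp _ _ (cg t)); exact: cvg_fst. Qed.

Lemma continuous_snd {T U V : topologicalType} (g : T -> U * V) :
  continuous g -> continuous (fun t => (g t).2).
Proof. by move=> cg t; apply: (cvg_comp _ _ (cg t)); exact: cvg_snd. Qed.

Lemma closed_eq_fct {R : realType} {T : topologicalType} (g h : T -> R) :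
  continuous g -> continuous h -> closed [set t | g t = h t].
Proof.
move=> cg ch; have -> : [set t | g t = h t] = (fun t => g t - h t) @^-1` [set 0].
  apply/seteqP; split=> t /=; first by move->; rewrite subrr.
  by move/eqP; rewrite subr_eq0 => /eqP.
have /continuous_closedP := fctB_continuous cg ch; apply.
exact: closed_eq.
Qed.

Ltac continuity_poly :=
  lazymatch goal with
  | |- continuous ?F =>
    lazymatch F with
    | (fun _ => ?c) => exact: cst_continuous
    | (fun t => t) => move=> ?; exact: cvg_id
    | (fun t => (@?g t - @?h t)%R) =>
        apply: (@fctB_continuous _ _ g h); continuity_poly
    | (fun t => (@?g t + @?h t)%R) =>
        apply: (@fctD_continuous _ _ g h); continuity_poly
    | (fun t => (@?g t * @?h t)%R) =>
        apply: (@fctM_continuous _ _ g h); continuity_poly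
    | (fun t => (@?g t).1) => apply: (@continuous_fst _ _ _ g); continuity_poly
    | (fun t => (@?g t).2) => apply: (@continuous_snd _ _ _ g); continuity_poly
    | fst => move=> ?; exact: cvg_fst
    | snd => move=> ?; exact: cvg_snd
    | _ => try assumption
    end
  end.

(** For each fixed [w] the condition is an equation between continuous functions of the parameter,
    and the set is the intersection over [w]. *)
Lemma closed_carries {R : realType} {T : topologicalType} (f : R -> R)
    (M : T -> (R * R) * (R * R)) (x y : T -> R) :
  continuous f -> continuous M -> continuous x -> continuous y ->
  closed [set t | carries f (M t) (x t) (y t)].
Proof.
move=> cf cM cx cy.
have cfc g : continuous g -> continuous (fun t : T => f (g t)).
  by move=> cg t; apply: (cvg_comp _ _ (cg t)); exact: cf.
pose E w := [set t | f (y t + ((M t).1.1 * (w - x t) + (M t).1.2 * (f w - f (x t)))) =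
                     f (y t) + ((M t).2.1 * (w - x t) + (M t).2.2 * (f w - f (x t)))].
have -> : [set t | carries f (M t) (x t) (y t)] = \bigcap_(w in setT) E w.
  by apply/seteqP; split=> t /= h w; [move=> _; exact: h | exact: (h w I)].
apply: closed_bigI => w _; apply: closed_eq_fct.
  by apply: (cfc); continuity_poly; apply: (cfc).
by continuity_poly; apply: (cfc).
Qed.

Lemma closed_mul2_eq1 {R : realType} {T : topologicalType}
    (M N : T -> (R * R) * (R * R)) :
  continuous M -> continuous N -> closed [set t | mul2 (N t) (M t) = id2].
Proof.
move=> cM cN.
have -> : [set t | mul2 (N t) (M t) = id2] =
   ([set t | (mul2 (N t) (M t)).1.1 = 1] `&` [set t | (mul2 (N t) (M t)).1.2 = 0]) `&`
   ([set t | (mul2 (N t) (M t)).2.1 = 0] `&` [set t | (mul2 (N t) (M t)).2.2 = 1]).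
  apply/seteqP; split=> t; first by rewrite /mul2 /id2 /= => -[-> -> -> ->].
  by rewrite /mul2 /= => -[[-> ->] [-> ->]].
by do 2!apply: closedI; apply: closed_eq_fct; rewrite /mul2 /=; continuity_poly.
Qed.

Lemma grid_approx {R : realType} (e b : R) : 0 < e ->
  exists q : int, `|b - q%:~R * e| <= e.
Proof.
move=> e0; exists (Num.floor (b / e)).
have := floor_le (b / e); have := floorD1_gt (b / e).
rewrite ltr_pdivrMr // intrD mulrDl mul1r ler_pdivlMr // => h1 h2.
by rewrite ler_distl; apply/andP; split; lra.
Qed.

(* Effros' theorem for the group of affine symmetries of the graph: the
   symmetries close to the identity move [x] to all nearby points. *)
Lemma carries_near_id {R : realType} (f : R -> R) : continuous f ->
  (forall x y, exists M N, [/\ mul2 N M = id2, mul2 M N = id2,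
     carries f M x y & carries f N y x]) ->
  forall x eps, 0 < eps ->
  \forall y \near x, exists2 M, near_id eps M & carries f M y x.
Proof.
move=> cf hf x eps eps0.
(* Entries of two matrices in one cell differ by at most [2 * step n]. Multiplying by a matrix with
   entries bounded by [n.+1] sums two such errors, giving [4 * step n * n.+1 = eps]. *)
pose step n : R := eps / (4 * n.+1%:R).
have step0 n : 0 < step n by rewrite divr_gt0 // mulr_gt0.
pose cell (i : nat * ((int * int) * (int * int))) : set ((R * R) * (R * R)) :=
  box ((i.2.1.1%:~R * step i.1, i.2.1.2%:~R * step i.1),
       (i.2.2.1%:~R * step i.1, i.2.2.2%:~R * step i.1)) (step i.1).
(* The index bounds [M] first and then confines [N] to a cell whose size depends on that bound.
   Countably many such compact sets exhaust all pairs [(M, N)]. *)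
pose K i := @box R ((0, 0), (0, 0)) i.1.+1%:R `*` cell i.
pose C := [set p : (((R * R) * (R * R)) * ((R * R) * (R * R))) * R |
   mul2 p.1.2 p.1.1 = id2] `&` ([set p | carries f p.1.1 x p.2] `&`
   [set p | carries f p.1.2 p.2 x]).
pose S i := [set y | exists2 p, K i p & C (p, y)].
have cC : closed C.
  apply: closedI; [|apply: closedI].
  - by apply: closed_mul2_eq1; continuity_poly.
  - by apply: closed_carries; continuity_poly.
  - by apply: closed_carries; continuity_poly.
have [|y|i [m Sm]] := @closed_cover_interior R _ S.
- move=> i; apply: closed_proj_compact => //.
  by apply: compact_setX; exact: box_compact.
- have [M [N [NM _ fM fN]]] := hf x y.
  pose s := `|M.1.1| + `|M.1.2| + (`|M.2.1| + `|M.2.2|).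
  pose n := Num.truncn s.
  have [q11 h11] := grid_approx N.1.1 (step0 n).
  have [q12 h12] := grid_approx N.1.2 (step0 n).
  have [q21 h21] := grid_approx N.2.1 (step0 n).
  have [q22 h22] := grid_approx N.2.2 (step0 n).
  exists (n, ((q11, q12), (q21, q22))), (M, N) => //; split; last exact/boxP.
  apply/boxP => /=; rewrite !subr0.
  have : s < n.+1%:R := truncnS_gt s.
  have := normr_ge0 M.1.1; have := normr_ge0 M.1.2.
  have := normr_ge0 M.2.1; have := normr_ge0 M.2.2.
  by rewrite /s => *; split; split; lra.
(* Fix one symmetry in [K i] from [x] to the interior point [m]. It sends a point [y] near [x] to
   [g y] near [m], and some [N'] in the same cell as [N] carries [g y] back to [x]. The product of
   [N'] and [M] is close to that of [N] and [M], the identity. *)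
have [[M N] [/boxP /= KM /boxP /= KN] [/= NM [fM fN]]] := nbhs_singleton Sm.
pose g y := m + (M.1.1 * (y - x) + M.1.2 * (f y - f x)).
have cg : continuous g by rewrite /g; continuity_poly.
have gx : g x = m by rewrite /g !subrr !mulr0 !addr0.
have : \forall y \near x, S i (g y) by apply: cg; rewrite gx.
apply: filterS => y [[M' N'] [/boxP /= KM' /boxP /= KN'] [/= NM' [fM' fN']]].
exists (mul2 N' M); last exact: carries_comp (carries_image y fM) fN'.
(* One entry of the product: [(a, b)] is a row of [N], [(a', b')] the same row of [N'], and [(u, v)]
   a column of [M]. *)
have est a b a' b' p q u v c : a * u + b * v = c ->
    `|a - p| <= step i.1 -> `|b - q| <= step i.1 ->
    `|a' - p| <= step i.1 -> `|b' - q| <= step i.1 ->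
    `|u| <= i.1.+1%:R -> `|v| <= i.1.+1%:R -> `|a' * u + b' * v - c| <= eps.
  move=> <- hap hbq ha'p hb'q hu hv.
  have -> : a' * u + b' * v - (a * u + b * v) =
     ((a' - p) - (a - p)) * u + ((b' - q) - (b - q)) * v by ring.
  have epsE : eps = (step i.1 + step i.1) * i.1.+1%:R +
                    (step i.1 + step i.1) * i.1.+1%:R.
    have n0 : i.1.+1%:R != 0 :> R by rewrite pnatr_eq0.
    by rewrite /step; field.
  rewrite epsE (le_trans (ler_normD _ _)) // lerD // normrM ler_pM //;
    by rewrite (le_trans (ler_normB _ _)) // lerD.
move: KM KN KN'; rewrite !subr0 => -[[? ?] [? ?]] [[? ?] [? ?]] [[? ?] [? ?]].
case: NM => e11 e12 e21 e22; split => /=.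
- by apply: est e11 _ _ _ _ _ _; eassumption.
- by rewrite -[X in `|X|]subr0; apply: est e12 _ _ _ _ _ _; eassumption.
- by rewrite -[X in `|X|]subr0; apply: est e21 _ _ _ _ _ _; eassumption.
- by apply: est e22 _ _ _ _ _ _; eassumption.
Qed.

(** * Touching parabolas and local C^{1,1} regularity *)

(** The pulled-back parabola is only an implicit bound on [v]. Its right side depends on the height
    above the pulled-back tangent line only through a factor of order [eps], so this dependence is
    absorbed into the left side. *)
Lemma parabola_transform {R : realType} (M : (R * R) * (R * R))
    (s C eps u v : R) :
  0 <= C -> near_id eps M -> eps * (16 * (C + 1) * (2 * `|s| + 3)) <= 1 ->
  `|u| <= 1 -> `|v| <= 1 ->
  M.2.1 * u + M.2.2 * v <= s * (M.1.1 * u + M.1.2 * v) +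
                           C * (M.1.1 * u + M.1.2 * v) ^+ 2 ->
  v <= (s * M.1.1 - M.2.1) / (M.2.2 - s * M.1.2) * u + 32 * C * u ^+ 2.
Proof.
case: M => [[a b] [c d]] /= C0 [/= ha hb hc hd] he hu hv h.
have q0 : 0 <= `|s| by [].
have e0 : 0 <= eps := le_trans (normr_ge0 _) hb.
have E1 : eps * (2 * `|s| + 3) <= 16^-1.
  suff : eps * (2 * `|s| + 3) * 1 <= eps * (2 * `|s| + 3) * (C + 1) by lra.
  by rewrite ler_wpM2l ?mulr_ge0 //; lra.
have E2 : C * (eps * (2 * `|s| + 3)) <= 16^-1.
  have : 0 <= eps * (2 * `|s| + 3) by rewrite mulr_ge0 //; lra.
  by lra.
have qe : 0 <= eps * `|s| by rewrite mulr_ge0.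
have qeE : eps * (2 * `|s| + 3) = 2 * (eps * `|s|) + 3 * eps by ring.
rewrite qeE in E1.
set D := d - s * b; set S := s * a - c.
have sb : `|s * b| <= eps * `|s| by rewrite normrM mulrC ler_wpM2r.
have D1 : `|D - 1| <= 16^-1.
  have -> : D - 1 = (d - 1) - s * b by rewrite /D; ring.
  by rewrite (le_trans (ler_normB _ _)) //; lra.
move: D1; rewrite ler_distl => /andP[D1 D2].
have S1 : `|S| <= `|s| + 1.
  have -> : S = s * (a - 1) + s - c by rewrite /S; ring.
  rewrite (le_trans (ler_normB _ _)) //.
  have : `|s * (a - 1) + s| <= eps * `|s| + `|s|.
    by rewrite (le_trans (ler_normD _ _)) // lerD2r normrM mulrC ler_wpM2r.
  by lra.
have Dn0 : D != 0 by apply/eqP => D0; move: D1; rewrite D0; lra.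
have Dp : 0 < D by lra.
have DV : D^-1 <= 2 by rewrite -[2]invrK lef_pV2 ?posrE ?invr_gt0 //; lra.
(* Up to the factor [D], [t] is the height above the line of slope [S / D]. The hypothesis becomes
   [t <= C * (al * u + be * t) ^+ 2] with [be] of order [eps]. *)
pose t := D * v - S * u.
have vE : v = S / D * u + t / D by rewrite /t; field.
have ht : `|t| <= `|s| + 3.
  rewrite (le_trans (ler_normB _ _)) // !normrM (gtr0_norm Dp).
  have : D * `|v| <= D by rewrite -[leRHS]mulr1 ler_wpM2l // ltW.
  have : `|S| * `|u| <= `|S| by rewrite -[leRHS]mulr1 ler_wpM2l.
  by lra.
pose al := a + b * S / D; pose be := b / D.
have abE : a * u + b * v = al * u + be * t by rewrite /al /be /t; field.
have bS : `|b * S| <= eps * (`|s| + 1) by rewrite normrM ler_pM.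
have hal : `|al| <= 2.
  have : `|b * S / D| <= eps * (`|s| + 1) * 2.
    by rewrite normrM ler_pM // gtr0_norm ?invr_gt0.
  have : `|a| <= eps + 1.
    have -> : a = (a - 1) + 1 by ring.
    by rewrite (le_trans (ler_normD _ _)) // normr1 lerD2r.
  rewrite /al; have := ler_normD a (b * S / D); lra.
have hbe : `|be| <= eps * 2.
  by rewrite /be normrM ler_pM // gtr0_norm ?invr_gt0.
have al2 : al ^+ 2 <= 4.
  have -> : 4 = 2 ^+ 2 :> R by ring.
  by rewrite -(real_normK (num_real al)) lerXn2r ?nnegrE.
have be2 : be ^+ 2 <= 4 * eps ^+ 2.
  have -> : 4 * eps ^+ 2 = (eps * 2) ^+ 2 :> R by ring.
  by rewrite -(real_normK (num_real be)) lerXn2r ?nnegrE // mulr_ge0.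
have tle : t <= C * (al * u + be * t) ^+ 2.
  by rewrite -abE /t /D /S; lra.
have tle2 : t <= 8 * C * u ^+ 2 + 8 * (C * eps ^+ 2 * t ^+ 2).
  apply: (le_trans tle).
  have h1 : (al * u + be * t) ^+ 2 <= 2 * (al ^+ 2 * u ^+ 2 + be ^+ 2 * t ^+ 2).
    by have := sqr_ge0 (al * u - be * t); lra.
  have h2 : al ^+ 2 * u ^+ 2 <= 4 * u ^+ 2 by rewrite ler_wpM2r ?sqr_ge0.
  have h3 : be ^+ 2 * t ^+ 2 <= 4 * eps ^+ 2 * t ^+ 2 by rewrite ler_wpM2r ?sqr_ge0.
  have h4 : (al * u + be * t) ^+ 2 <= 8 * u ^+ 2 + 8 * (eps ^+ 2 * t ^+ 2) by lra.
  by have := ler_wpM2l C0 h4; lra.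
have u2 : 0 <= C * u ^+ 2 by rewrite mulr_ge0 ?sqr_ge0.
(* For [t > 0] the choice of [eps] makes the term [8 * (C * eps ^+ 2 * t ^+ 2)] at most [t / 2].
   This doubles 8 to 16, and division by [D >= 1 / 2] gives the final 32. *)
have tfin : t <= 16 * (C * u ^+ 2).
  have [t0|t0] := leP t 0; first by lra.
  have ht' : t <= `|s| + 3 by rewrite -(gtr0_norm t0).
  have : C * eps ^+ 2 * t ^+ 2 <= 16^-1 * t.
    have -> : C * eps ^+ 2 * t ^+ 2 = (C * (eps * t)) * (eps * t) by ring.
    have h1 : eps * t <= eps * (2 * `|s| + 3) by rewrite ler_wpM2l //; lra.
    have h2 : C * (eps * t) <= 16^-1 by apply: le_trans E2; rewrite ler_wpM2l.
    apply: ler_pM => //; rewrite ?mulr_ge0 ?(ltW t0) //.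
    by rewrite -[leRHS]mul1r ler_wpM2r ?(ltW t0) //; lra.
  by lra.
rewrite [leLHS]vE lerD2l.
have [t0|t0] := leP t 0.
  apply: (@le_trans _ _ 0); last lra.
  by rewrite mulr_le0_ge0 // invr_ge0 ltW.
by have := ler_pM (ltW t0) _ tfin DV; rewrite invr_ge0 ltW // => /(_ erefl); lra.
Qed.

(** The parabola at [x] is pulled back by a symmetry close to the identity that carries [y] to [x].
    The slope depends on [y], but the opening and the range of validity do not. *)
Lemma touching_parabolas_near {R : realType} (f : R -> R) (x s C d : R) :
  continuous f -> 0 < d -> 0 <= C ->
  (forall z, `|z - x| <= d -> f z <= f x + s * (z - x) + C * (z - x) ^+ 2) ->
  (forall eps, 0 < eps ->
     \forall y \near x, exists2 M, near_id eps M & carries f M y x) ->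
  exists2 r, 0 < r & forall y, `|y - x| < r -> exists s', forall w, `|w - x| < r ->
    f w - f y <= s' * (w - y) + 32 * C * (w - y) ^+ 2.
Proof.
move=> cf d0 C0 touch eff.
pose Q : R := 16 * (C + 1) * (2 * `|s| + 3).
have q0 : 0 <= `|s| by [].
have Q1 : 1 <= Q.
  suff : 1 * 1 <= (C + 1) * (2 * `|s| + 3) by rewrite /Q; lra.
  by apply: ler_pM => //; lra.
have Q0 : 0 < Q by lra.
(* The bound [Q^-1] is the smallness that [parabola_transform] requires. With [r <= d / 8], the
   image of [w] has abscissa within [2 * (2 * r) + eps <= d] of [x], where the parabola is valid. *)
pose eps := Num.min (d / 2) Q^-1.
have eps0 : 0 < eps by rewrite lt_min divr_gt0 // invr_gt0.
have epsd : eps <= d / 2 by rewrite ge_min lexx.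
have epsQ : eps * Q <= 1 by rewrite -ler_pdivlMr // div1r ge_min lexx orbT.
have eps1 : eps <= 1.
  by apply: le_trans epsQ; rewrite -[leLHS]mulr1 ler_wpM2l // ltW.
have near_f : \forall w \near x, `|f w - f x| < 2^-1.
  have := cf x; move/cvgr_dist_lt => /(_ 2^-1); rewrite invr_gt0 ltr0n => /(_ erefl).
  by apply: filterS => w; rewrite distrC.
have [r1 /= r10 Hr1] : nbhs_ball x (fun y =>
    (exists2 M, near_id eps M & carries f M y x) /\ `|f y - f x| < 2^-1).
  by apply/nbhs_ballP; apply: filterI near_f; exact: eff.
pose r := Num.min r1 (Num.min (d / 8) 2^-1).
have r0 : 0 < r by rewrite !lt_min r10 divr_gt0 //= invr_gt0.
have rr1 : r <= r1 by rewrite ge_min lexx.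
have rd : r <= d / 8 by rewrite !ge_min lexx orbT.
have rh : r <= 2^-1 by rewrite !ge_min lexx !orbT.
exists r => // y yr.
have [|[M nM fM] fy] := Hr1 y; first by rewrite /ball /= distrC; lra.
exists ((s * M.1.1 - M.2.1) / (M.2.2 - s * M.1.2)) => w wr.
have [|_ fw] := Hr1 w; first by rewrite /ball /= distrC; lra.
have hu : `|w - y| <= 2 * r.
  have -> : w - y = (w - x) - (y - x) by ring.
  by rewrite (le_trans (ler_normB _ _)) //; lra.
have hv : `|f w - f y| <= 1.
  have -> : f w - f y = (f w - f x) - (f y - f x) by ring.
  by rewrite (le_trans (ler_normB _ _)) //; lra.
apply: (@parabola_transform _ M s C eps) => //; first lra.
have := fM w; set z := x + _ => fz.
have zx : z - x = M.1.1 * (w - y) + M.1.2 * (f w - f y) by rewrite /z; ring.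
have := touch z; rewrite fz zx => h.
suff /h : `|M.1.1 * (w - y) + M.1.2 * (f w - f y)| <= d by lra.
case: nM => h11 h12 _ _.
have a2 : `|M.1.1| <= 2.
  have -> : M.1.1 = (M.1.1 - 1) + 1 by ring.
  by rewrite (le_trans (ler_normD _ _)) // normr1; lra.
rewrite (le_trans (ler_normD _ _)) // !normrM.
have : `|M.1.1| * `|w - y| <= 2 * (2 * r) by rewrite ler_pM.
have : `|M.1.2| * `|f w - f y| <= eps * 1 by rewrite ler_pM.
by lra.
Qed.

(** Subtract a parabola centered at the midpoint, so steep that the difference attains its maximum
    inside the interval. At that maximizer a translate of the parabola touches the graph from
    above. *)
Lemma exists_touching_parabola {R : realType} (f : R -> R) (l r : R) :
  continuous f -> l < r -> exists x s C, [/\ l < x < r, 0 <= C &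
    forall z, l <= z <= r -> f z <= f x + s * (z - x) + C * (z - x) ^+ 2].
Proof.
move=> cf lr; pose c := (l + r) / 2.
have [m mI fm] := @EVT_max R f l r (ltW lr) (continuous_subspaceT cf).
pose rho := (r - l) / 2.
have rho0 : 0 < rho by rewrite /rho; lra.
(* At the endpoints the difference is at most [f m - (f m - f c + 1)], which is below its value
   [f c] at the center. *)
pose K := (f m - f c + 1) / rho ^+ 2.
have fc : f c <= f m by apply: fm; rewrite in_itv /= /c; lra.
have K0 : 0 <= K by rewrite divr_ge0 ?sqr_ge0 //; lra.
have cg : continuous (fun z => f z - K * ((z - c) * (z - c))).
  by continuity_poly.
have [x xI gx] := @EVT_max R _ l r (ltW lr) (continuous_subspaceT cg).
have xc : `|x - c| < rho.
  rewrite ltNge; apply/negP => h.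
  have : rho ^+ 2 <= (x - c) * (x - c).
    by rewrite -expr2 -(real_normK (num_real (x - c))) lerXn2r ?nnegrE // ltW.
  move=> /(ler_wpM2l K0); rewrite {1}/K divfK ?expf_neq0 ?gt_eqF // => h1.
  have := gx c; rewrite subrr !mulr0 subr0 in_itv /= => h2.
  have /h2 : l <= c <= r by rewrite /c; lra.
  by have := fm x xI; lra.
exists x, (2 * K * (x - c)), K; split=> //.
  by move: xc; rewrite ltr_distl /rho /c; lra.
move=> z zI; have := gx z; rewrite in_itv /= => /(_ zI).
have -> : f x + 2 * K * (x - c) * (z - x) + K * (z - x) ^+ 2 =
   f x - K * ((x - c) * (x - c)) + K * ((z - c) * (z - c)) by ring.
by lra.
Qed.

(** Taking [u] small with the sign of [k] gives [|k| <= A * |u|], which fails for [k != 0] once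
    [|u|] is small enough. *)
Lemma linear_le_square {R : realType} (k A rho : R) : 0 < rho ->
  (forall u, `|u| < rho -> k * u <= A * u ^+ 2) -> k = 0.
Proof.
move=> rho0 h; apply: contrapT => /eqP k0.
have nk : 0 < `|k| by rewrite normr_gt0.
pose e := Num.min (rho / 2) (`|k| / (2 * (`|A| + 1))).
have A1 : 0 < 2 * (`|A| + 1) by rewrite mulr_gt0 // ltr_wpDl.
have e0 : 0 < e by rewrite lt_min !divr_gt0.
have erho : e < rho by rewrite gt_min; apply/orP; left; lra.
have eA : `|A| * e <= `|k| / 2.
  have : e * (2 * (`|A| + 1)) <= `|k| by rewrite -ler_pdivlMr // ge_min lexx orbT.
  by lra.
have := h (Num.sg k * e); rewrite normrM normr_sg k0 mul1r gtr0_norm // => /(_ erho).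
rewrite mulrA (mulrC k) -normrEsg exprMn sqr_sg k0 mul1r expr2 mulrA.
rewrite ler_pM2r // => h1.
have : A * e <= `|A| * e by rewrite ler_wpM2r ?ler_norm // ltW.
by lra.
Qed.

Lemma locally_C11 {R : realType} (f : R -> R) : continuous f ->
  (forall x eps, 0 < eps ->
     \forall y \near x, exists2 M, near_id eps M & carries f M y x) ->
  exists q r C (g : R -> R), 0 < r /\ forall y w, `|y - q| < r -> `|w - q| < r ->
    `|f w - f y - g y * (w - y)| <= C * (w - y) ^+ 2.
Proof.
move=> cf eff.
have [x [s [C [xI C0 touch]]]] : exists x s C, [/\ 0 < x < 1, 0 <= C &
    forall z, 0 <= z <= 1 -> f z <= f x + s * (z - x) + C * (z - x) ^+ 2].
  exact: exists_touching_parabola.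
pose d0 := Num.min x (1 - x).
have dl0 : d0 <= x by rewrite ge_min lexx.
have dr0 : d0 <= 1 - x by rewrite ge_min lexx orbT.
have [||||r1 r10 H1] := @touching_parabolas_near _ f x s C d0 cf.
- by rewrite lt_min; lra.
- exact: C0.
- by move=> z; rewrite ler_distl => h; apply: touch; lra.
- exact: eff.
(* The argument is repeated for [- f] inside the ball where upper parabolas already exist, so that
   both kinds exist near [q]. *)
have cNf : continuous (fun z => - f z) by move=> z; apply: cvgN; exact: cf.
have [|q [s' [C' [qI C'0 touch']]]] :=
  @exists_touching_parabola _ _ (x - r1 / 2) (x + r1 / 2) cNf; first by lra.
pose d := Num.min (q - (x - r1 / 2)) (x + r1 / 2 - q).
have dl : d <= q - (x - r1 / 2) by rewrite ge_min lexx.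
have dr : d <= x + r1 / 2 - q by rewrite ge_min lexx orbT.
have [||||r2 r20 H2] := @touching_parabolas_near _ _ q s' C' d cNf.
- by rewrite lt_min; lra.
- exact: C'0.
- by move=> z; rewrite ler_distl => h; apply: touch'; lra.
- move=> eps eps0; apply: filterS (eff q eps eps0) => y [M [m11 m12 m21 m22] fM].
  by exists ((M.1.1, - M.1.2), (- M.2.1, M.2.2)); [split; rewrite //= normrN | exact: carriesN].
pose r := Num.min r2 (r1 / 2).
have r0 : 0 < r by rewrite lt_min r20 divr_gt0.
have rr2 : r <= r2 by rewrite ge_min lexx.
have rr1 : r <= r1 / 2 by rewrite ge_min lexx orbT.
(* The radius condition stands under the existential so that [choice] yields a total function;
   outside the ball the slope is 0. *)
suff H y : exists g, `|y - q| < r -> forall w, `|w - q| < r ->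
    `|f w - f y - g * (w - y)| <= (32 * C + 32 * C') * (w - y) ^+ 2.
  have [g Hg] := choice H.
  by exists q, r, (32 * C + 32 * C'), g; split=> // y w yr wr; exact: Hg.
have in1 z : `|z - q| < r -> `|z - x| < r1.
  by rewrite !ltr_distl; lra.
have [yr|] := pselect (`|y - q| < r); last by exists 0.
have [s1 h1] := H1 y (in1 _ yr).
have [s2 h2] := H2 y (lt_le_trans yr rr2).
have both w : `|w - q| < r ->
    f w - f y <= s1 * (w - y) + 32 * C * (w - y) ^+ 2 /\
    - s2 * (w - y) - 32 * C' * (w - y) ^+ 2 <= f w - f y.
  move=> wr; split; first exact: h1 (in1 _ wr).
  by have := h2 w (lt_le_trans wr rr2); lra.
(* The lower parabola lies below the upper one and they meet at [y], so their tangents there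
   coincide. *)
have /eqP : - s2 - s1 = 0.
  apply: (@linear_le_square _ _ (32 * C + 32 * C') (r - `|y - q|)).
    by rewrite subr_gt0.
  move=> u hu; have [|] := both (y + u).
    have -> : y + u - q = (y - q) + u by ring.
    by rewrite (le_lt_trans (ler_normD _ _)) //; lra.
  have -> : y + u - y = u by ring.
  by lra.
rewrite subr_eq0 => /eqP s12; exists s1 => _ w wr.
have [] := both w wr; rewrite s12 ler_distl => k1 k2.
have := mulr_ge0 C0 (sqr_ge0 (w - y)); have := mulr_ge0 C'0 (sqr_ge0 (w - y)).
by lra.
Qed.

(** * Transport of slopes by a symmetry *)

(** An injective continuous function on the line is strictly monotone; [k] is the common sign of its
    difference quotients. *)
Lemma injective_continuous_sign {R : realType} (c : R -> R) :
  continuous c -> injective c -> exists2 k : R, k = 1 \/ k = -1 &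
    forall x y, x != y -> 0 < k * ((c y - c x) / (y - x)).
Proof.
move=> cc ic.
have [| |inc|dec] := @itv_continuous_inj_mono R c `]-oo, +oo[.
- exact: continuous_subspaceT.
- by move=> x y _ _; exact: ic.
- exists 1; first by left.
  move=> x y xy; rewrite mul1r.
  wlog lxy : x y xy / x < y.
    move=> H; have [xly|ylx|e] := ltgtP x y; first exact: H.
      have := H y x; rewrite eq_sym xy ylx => /(_ erefl erefl).
      by rewrite -(opprB (c y)) -(opprB y) invrN mulrNN.
    by rewrite e eqxx in xy.
  by apply: divr_gt0; rewrite subr_gt0 //; apply: inc; rewrite ?in_itv.
- exists (-1); first by right.
  move=> x y xy; rewrite mulN1r -mulNr opprB.
  wlog lxy : x y xy / x < y.
    move=> H; have [xly|ylx|e] := ltgtP x y; first exact: H.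
      have := H y x; rewrite eq_sym xy ylx => /(_ erefl erefl).
      by rewrite -(opprB (c x)) -(opprB y) invrN mulrNN.
    by rewrite e eqxx in xy.
  by apply: divr_gt0; rewrite subr_gt0 //; apply: dec; rewrite ?in_itv.
Qed.

(** Near a pole the denominator tends to 0 while the numerator stays away from 0. Points where the
    denominator vanishes are excluded because division by 0 returns 0. *)
Lemma mobius_cvg_infty {R : realType} {T : Type} {F : set_system T}
    {FF : Filter F} (Q : T -> R) (a b c d t : R) :
  Q @ F --> t -> a + b * t = 0 -> c + d * t != 0 ->
  forall A, \forall x \near F, a + b * Q x != 0 ->
    A < `|(c + d * Q x) / (a + b * Q x)|.
Proof.
move=> Qt ab0 cd0 A.
have den : a + b * Q x @[x --> F] --> 0.
  by rewrite -ab0; apply: cvgD; [exact: cvg_cst | apply: cvgM; [exact: cvg_cst|]].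
have num : c + d * Q x @[x --> F] --> c + d * t.
  by apply: cvgD; [exact: cvg_cst | apply: cvgM; [exact: cvg_cst|]].
have e0 : 0 < `|c + d * t| by rewrite normr_gt0.
have A1 : 0 < `|A| + 1 by rewrite ltr_wpDl.
have bnd : 0 < `|c + d * t| / 2 / (`|A| + 1) by rewrite !divr_gt0.
have h1 : \forall x \near F,
    `|a + b * Q x| < `|c + d * t| / 2 / (`|A| + 1) by exact: cvgr0_norm_lt.
have h2 : \forall x \near F, `|c + d * t| / 2 < `|c + d * Q x|.
  by apply: cvgr_norm_gt num _ _; lra.
apply: filterS2 h1 h2 => x; rewrite ltr_pdivlMr // => h1 h2 n0.
rewrite normrM normfV ltr_pdivlMr ?normr_gt0 //.
apply: le_lt_trans h2; apply: le_trans (ltW h1).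
by rewrite mulrC ler_wpM2l // (le_trans (ler_norm A)) // lerDl.
Qed.

Lemma carriesK {R : realType} (f : R -> R) M N x y v :
  mul2 M N = id2 -> carries f N y x ->
  let w := x + (N.1.1 * (v - y) + N.1.2 * (f v - f y)) in
  y + (M.1.1 * (w - x) + M.1.2 * (f w - f x)) = v.
Proof.
case=> m11 m12 _ _ fN w; rewrite /w fN.
transitivity (y + ((M.1.1 * N.1.1 + M.1.2 * N.2.1) * (v - y) +
  (M.1.1 * N.1.2 + M.1.2 * N.2.2) * (f v - f y))); first by ring.
by rewrite m11 m12; ring.
Qed.

(** Otherwise the nonzero vector [(1, t)] would lie in the kernel of the invertible matrix [M]. *)
Lemma carries_det_neq0 {R : realType} (M N : (R * R) * (R * R)) (t : R) :
  mul2 N M = id2 -> M.1.1 + M.1.2 * t = 0 -> M.2.1 + M.2.2 * t != 0.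
Proof.
move=> NM e1; apply/eqP => e2; case: NM => n11 n12 n21 n22.
suff : 1 = 0 :> R by apply/eqP; rewrite oner_eq0.
rewrite -n11.
have t1 : (N.1.1 * M.1.1 + N.1.2 * M.2.1) + (N.1.1 * M.1.2 + N.1.2 * M.2.2) * t =
   N.1.1 * (M.1.1 + M.1.2 * t) + N.1.2 * (M.2.1 + M.2.2 * t) by ring.
by move: t1; rewrite e1 e2 !mulr0 addr0 n12 mul0r addr0.
Qed.

Section transport.
Context {R : realType} (f : R -> R) (M N : (R * R) * (R * R)) (x y : R).
Hypotheses (cf : continuous f) (NM : mul2 N M = id2) (MN : mul2 M N = id2).
Hypotheses (fM : carries f M x y) (fN : carries f N y x).

(** Abscissa of the image of [(v, f v)] under the symmetry that carries [y] back to [x]. *)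
Let chi v := x + (N.1.1 * (v - y) + N.1.2 * (f v - f y)).

Let f_chi v : f (chi v) = f x + (N.2.1 * (v - y) + N.2.2 * (f v - f y)).
Proof. exact: fN. Qed.

Let chiK v : y + (M.1.1 * (chi v - x) + M.1.2 * (f (chi v) - f x)) = v.
Proof. exact: carriesK. Qed.

Let fchiK v : f y + (M.2.1 * (chi v - x) + M.2.2 * (f (chi v) - f x)) = f v.
Proof. by rewrite -fM chiK. Qed.

Let chi_continuous : continuous chi.
Proof. by rewrite /chi; continuity_poly. Qed.

Let chiy : chi y = x.
Proof. by rewrite /chi !subrr !mulr0 !addr0. Qed.

Let chi_inj : injective chi.
Proof. by move=> u v e; rewrite -(chiK u) -(chiK v) e. Qed.

Let q w := (f w - f x) / (w - x).

Let chi_neq h : h != 0 -> chi (y + h) - x != 0.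
Proof.
by rewrite subr_eq0 -chiy => h0; apply/eqP => /chi_inj /eqP;
  rewrite -subr_eq0 addrAC subrr add0r (negPf h0).
Qed.

(** The denominator of the Möbius map is the reciprocal of a difference quotient of [chi], so its
    sign is constant. *)
Let denE h : h != 0 ->
  M.1.1 + M.1.2 * q (chi (y + h)) = (y + h - y) / (chi (y + h) - chi y).
Proof.
move=> h0; rewrite chiy /q -{3}(chiK (y + h)); field; exact: chi_neq.
Qed.

Let diff_quotientE h : h != 0 -> (f (y + h) - f y) / h =
  (M.2.1 + M.2.2 * q (chi (y + h))) / (M.1.1 + M.1.2 * q (chi (y + h))).
Proof.
move=> h0; have n0 := chi_neq h0; rewrite (denE h0) chiy /q -{1}(fchiK (y + h)).
have -> : y + h - y = h by ring.
by field; rewrite h0 n0.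
Qed.

(** Injectivity of [chi] keeps [chi (y + h)] away from [x], so punctured limits can be composed. *)
Let chi_dnbhs : chi (y + h) @[h --> 0^'] --> x^'.
Proof.
have c : chi (y + h) @[h --> 0] --> x.
  have yh : y + h @[h --> 0] --> y + 0.
    by apply: cvgD; [exact: cvg_cst | exact: cvg_id].
  rewrite addr0 in yh; have := cvg_comp _ _ yh (@chi_continuous y).
  by rewrite chiy.
move=> P xP; change (\forall h \near 0, h != 0 -> P (chi (y + h))).
have : \forall h \near 0, chi (y + h) != x -> P (chi (y + h)) := c _ xP.
apply: filterS => h hP h0.
by apply: hP; rewrite -subr_eq0; exact: chi_neq.
Qed.

Variable t : R.
Hypothesis ft : q w @[w --> x^'] --> t.

Let qchi : q (chi (y + h)) @[h --> 0^'] --> t.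
Proof. exact: cvg_comp chi_dnbhs ft. Qed.

Lemma carries_ederive_fin : M.1.1 + M.1.2 * t != 0 ->
  diff_quotient f y h @[h --> 0^'] -->
    ((M.2.1 + M.2.2 * t) / (M.1.1 + M.1.2 * t))%:E.
Proof.
move=> n0; apply: cvg_EFin; first exact: nearW.
have E : {near 0^', (fun h => (M.2.1 + M.2.2 * q (chi (y + h))) /
    (M.1.1 + M.1.2 * q (chi (y + h)))) =1 fine \o diff_quotient f y}.
  by apply: filterS (nbhs_dnbhs_neq 0) => h h0; rewrite /= -diff_quotientE.
apply: cvg_trans (near_eq_cvg E) _.
apply: cvgM; last apply: cvgV => //.
  by apply: cvgD; [exact: cvg_cst | apply: cvgM; [exact: cvg_cst|]].
by apply: cvgD; [exact: cvg_cst | apply: cvgM; [exact: cvg_cst|]].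
Qed.

(* The sign of the quotient is that of [M.2.1 + M.2.2 * t] times the sign of
   the slopes of the monotone map [chi], so both one-sided limits agree. *)
Lemma carries_ederive_infty : M.1.1 + M.1.2 * t = 0 ->
  diff_quotient f y h @[h --> 0^'] --> +oo%E \/
  diff_quotient f y h @[h --> 0^'] --> -oo%E.
Proof.
move=> ab0; have cd0 := carries_det_neq0 NM ab0.
have [k k1 ksgn] := injective_continuous_sign chi_continuous chi_inj.
have den_sgn h : h != 0 -> 0 < k * (M.1.1 + M.1.2 * q (chi (y + h))).
  move=> h0; have := ksgn y (y + h).
  rewrite denE // -{1}(addr0 y) (inj_eq (addrI y)) eq_sym h0 => /(_ erefl).
  rewrite -(invf_div (_ - _)).
  by case: k1 => ->; rewrite ?mul1r ?mulN1r ?oppr_gt0 ?invr_gt0 ?invr_lt0.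
set e := M.2.1 + M.2.2 * t in cd0.
have num_sgn : \forall h \near 0^', 0 < Num.sg e * (M.2.1 + M.2.2 * q (chi (y + h))).
  have num : M.2.1 + M.2.2 * q (chi (y + h)) @[h --> 0^'] --> e.
    by apply: cvgD; [exact: cvg_cst | apply: cvgM; [exact: cvg_cst|]].
  have : Num.sg e * (M.2.1 + M.2.2 * q (chi (y + h))) @[h --> 0^'] --> Num.sg e * e.
    by apply: cvgM; [exact: cvg_cst|].
  by move/cvgr_gt; apply; rewrite -normrEsg normr_gt0.
have quot_sgn : \forall h \near 0^', 0 < (k * Num.sg e) * ((f (y + h) - f y) / h).
  apply: filterS2 (nbhs_dnbhs_neq 0) num_sgn => h h0 s0; have d0 := den_sgn h h0.
  rewrite diff_quotientE //; move: d0 s0.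
  set u := _ + _ => d0; set v := _ + _ => s0.
  have u0 : u != 0 by apply/eqP => uE; rewrite uE mulr0 ltxx in d0.
  (* Writing [v / u] as [v * u / u ^+ 2] splits the sign between numerator and denominator. *)
  have -> : k * Num.sg e * (v / u) = (Num.sg e * v) * (k * u) / u ^+ 2 by field.
  by apply: divr_gt0; [exact: mulr_gt0 | rewrite exprn_even_gt0].
have big A : \forall h \near 0^', A < `|(f (y + h) - f y) / h|.
  apply: filterS2 (nbhs_dnbhs_neq 0) (mobius_cvg_infty qchi ab0 cd0 A) => h h0.
  rewrite diff_quotientE //; apply; apply/eqP => d0.
  by have := den_sgn h h0; rewrite d0 mulr0 ltxx.
have [kE|kE] : k * Num.sg e = 1 \/ k * Num.sg e = -1.
  have [e0|e0|e0] := sgrP e; case: k1 => ->; rewrite ?mul1r ?mulN1r ?opprK; auto.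
    by rewrite e0 eqxx in cd0.
  by rewrite e0 eqxx in cd0.
- left; apply/cvgeyPgt => A; apply: filterS2 quot_sgn (big A) => h.
  by rewrite kE mul1r => /gtr0_norm ->; rewrite /diff_quotient lte_fin.
- right; apply/cvgeNyPlt => A; apply: filterS2 quot_sgn (big (- A)) => h.
  rewrite kE mulN1r oppr_gt0 => /ltr0_norm ->.
  by rewrite ltrN2 /diff_quotient lte_fin.
Qed.

End transport.

(** * From the quadratic estimate to the derivative and its continuity *)

Lemma slope_cvg {R : realType} (f : R -> R) (y g C r : R) : 0 < r ->
  (forall w, `|w - y| < r -> `|f w - f y - g * (w - y)| <= C * (w - y) ^+ 2) ->
  (f w - f y) / (w - y) @[w --> y^'] --> g.
Proof.
move=> r0 h; apply/cvgrPdist_lt => e e0.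
have A1 : 0 < `|C| + 1 by rewrite ltr_wpDl.
have m0 : 0 < Num.min r (e / (`|C| + 1)) by rewrite lt_min r0 divr_gt0.
apply: filterS (dnbhs_ball y m0) => w [] /=.
rewrite /ball /= distrC lt_min ltr_pdivlMr // => /andP[wr we] /eqP wy.
have d0 : w - y != 0 by rewrite subr_eq0.
have dp : 0 < `|w - y| by rewrite normr_gt0.
have -> : g - (f w - f y) / (w - y) = - ((f w - f y - g * (w - y)) / (w - y)).
  by field.
rewrite normrN normrM normfV ltr_pdivrMr //; apply: le_lt_trans (h w wr) _.
rewrite -(real_normK (num_real (w - y))) expr2 mulrA ltr_pM2r //.
apply: le_lt_trans we; rewrite mulrC ler_wpM2l //.
by rewrite (le_trans (ler_norm C)) // lerDl.
Qed.

(** Expanding the same increment of [f] from [q] and from [w] and adding the two estimates bounds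
    [|g q - g w|] by [2 * C * |w - q|]. *)
Lemma slope_continuous {R : realType} (f g : R -> R) (q r C : R) : 0 < r ->
  (forall y w, `|y - q| < r -> `|w - q| < r ->
    `|f w - f y - g y * (w - y)| <= C * (w - y) ^+ 2) ->
  {for q, continuous g}.
Proof.
move=> r0 h; apply/cvgrPdist_lt => e e0.
have A1 : 0 < 2 * `|C| + 1 by rewrite ltr_wpDl // mulr_ge0.
have m0 : 0 < Num.min r (e / (2 * `|C| + 1)) by rewrite lt_min r0 divr_gt0.
apply: filterS (nbhsx_ballx q _ m0) => w.
rewrite /ball /= distrC lt_min ltr_pdivlMr // => /andP[wr we].
have qr : `|q - q| < r by rewrite subrr normr0.
have [->|wq] := eqVneq w q; first by rewrite subrr normr0.
have dp : 0 < `|w - q| by rewrite normr_gt0 subr_eq0.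
rewrite -(ltr_pM2r dp) -normrM.
have -> : (g q - g w) * (w - q) =
   - (f w - f q - g q * (w - q)) - (f q - f w - g w * (q - w)) by ring.
apply: le_lt_trans (ler_normB _ _) _; rewrite normrN.
have h1 := h q w qr wr; have h2 := h w q wr qr.
rewrite -(sqrrN (q - w)) opprB in h2.
apply: le_lt_trans (lerD h1 h2) _.
rewrite -(real_normK (num_real (w - q))) expr2 -mulrDl mulrA ltr_pM2r //.
apply: le_lt_trans we; rewrite [leRHS]mulrC ler_wpM2r //.
by have := ler_norm C; lra.
Qed.

Theorem mainTheorem1 (R : realType) (f : R -> R) :
  continuous f ->
  affinely_ambient_homogeneous (graph_of f) ->
  (forall x : R, ederivable f x) /\
  (forall x : R, ederive_continuous_at f x).
Proof.
move=> cf /homogeneous_carries hf.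
have [q [r [C [g [r0 quad]]]]] := locally_C11 cf (carries_near_id cf hf).
have slope y : `|y - q| < r -> (f w - f y) / (w - y) @[w --> y^'] --> g y.
  move=> yr; have ry : 0 < r - `|y - q| by rewrite subr_gt0.
  apply: slope_cvg ry _ => w wy; apply: quad => //.
  have -> : w - q = (w - y) + (y - q) by ring.
  by rewrite (le_lt_trans (ler_normD _ _)) // -ltrBrDr.
have qr : `|q - q| < r by rewrite subrr normr0.
split=> x; have [M [N [NM MN fM fN]]] := hf q x.
  have [ab0|ab0] := eqVneq (M.1.1 + M.1.2 * g q) 0.
    have [h|h] := carries_ederive_infty cf NM MN fM fN (slope q qr) ab0;
      exact: cvgP h.
  exact: cvgP (carries_ederive_fin cf MN fM fN (slope q qr) ab0).
(* [chi v] is the point that the fixed symmetry carries to [v], so a single Möbius map gives the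
   derivative at every [v] near [x] from the slope at [chi v] near [q]. *)
pose chi v := q + (N.1.1 * (v - x) + N.1.2 * (f v - f x)).
have cchi : continuous chi by rewrite /chi; continuity_poly.
have chix : chi x = q by rewrite /chi !subrr !mulr0 !addr0.
have gchi : g (chi v) @[v --> x] --> g q.
  apply: (cvg_comp _ _ (cchi x)); rewrite chix; exact: slope_continuous quad.
have near_r : \forall v \near x, `|chi v - q| < r.
  have := cchi x; rewrite /continuous_at chix => /cvgr_distC_lt; exact.
have chiM v : carries f M (chi v) v.
  by rewrite -[X in carries _ _ _ X](carriesK v MN fN); exact: carries_image.
have chiN v : carries f N v (chi v) by exact: carries_image.
have lim_fin v : `|chi v - q| < r -> M.1.1 + M.1.2 * g (chi v) != 0 ->
    ederive f v =
      ((M.2.1 + M.2.2 * g (chi v)) / (M.1.1 + M.1.2 * g (chi v)))%:E.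
  move=> vr n0; have h := carries_ederive_fin cf MN (chiM v) (chiN v) (slope _ vr) n0.
  exact: (cvg_lim (@ereal_hausdorff R) h).
have lim_infty v : `|chi v - q| < r -> M.1.1 + M.1.2 * g (chi v) = 0 ->
    ederive f v = +oo%E \/ ederive f v = -oo%E.
  move=> vr n0.
  by have [h|h] := carries_ederive_infty cf NM MN (chiM v) (chiN v) (slope _ vr) n0;
    [left|right]; exact: (cvg_lim (@ereal_hausdorff R) h).
have den : M.1.1 + M.1.2 * g (chi v) @[v --> x] --> M.1.1 + M.1.2 * g q.
  by apply: cvgD; [exact: cvg_cst | apply: cvgM; [exact: cvg_cst|]].
have num : M.2.1 + M.2.2 * g (chi v) @[v --> x] --> M.2.1 + M.2.2 * g q.
  by apply: cvgD; [exact: cvg_cst | apply: cvgM; [exact: cvg_cst|]].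
rewrite /ederive_continuous_at.
have [ab0|ab0] := eqVneq (M.1.1 + M.1.2 * g q) 0; last first.
  have := lim_fin x; rewrite chix => /(_ qr ab0) ->.
  have den0 : \forall v \near x, M.1.1 + M.1.2 * g (chi v) != 0.
    exact: cvgr_neq0 den ab0.
  have E : {near x, (fun v => ((M.2.1 + M.2.2 * g (chi v)) /
      (M.1.1 + M.1.2 * g (chi v)))%:E) =1 ederive f}.
    by apply: filterS2 near_r den0 => v vr n0; rewrite lim_fin.
  apply: cvg_trans (near_eq_cvg E) _.
  apply: cvg_EFin; first exact: nearW.
  by apply: cvgM => //; exact: cvgV.
suff big : `|ederive f v|%E @[v --> x] --> +oo%E.
  by have := lim_infty x; rewrite chix => /(_ qr ab0) [] ->.
apply/cvgeyPgt => A.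
have cd0 : M.2.1 + M.2.2 * g q != 0 by exact: carries_det_neq0 NM ab0.
apply: filterS2 near_r (mobius_cvg_infty gchi ab0 cd0 A) => v vr big.
(* Further poles may accumulate at [x]; at each of them the derivative is itself infinite. *)
have [n0|n0] := eqVneq (M.1.1 + M.1.2 * g (chi v)) 0.
  by have [] := lim_infty v vr n0 => ->; rewrite /= ltry.
by rewrite lim_fin //= lte_fin; exact: big.
Qed.
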